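(* Let $m\ge1$ be an integer and $a_m$ a nonzero real constant. For $r=0,1,\dots,m$ consider the $m+1$ first-order time-marching finite-difference schemes $$u(x,\Delta t)=\sum_{k=-r}^{m-r}c_k\,u(x+k\Delta x,0),\qquad c_0=1+(-1)^m(-1)^rC_r^m\nu_m,\qquad c_k=(-1)^m(-1)^{r+k}C_{r+k}^m\nu_m\ \ (k\ne0),$$ with $\nu_m=\Delta t\,a_m/\Delta x^m$, for solving the equation $$\frac{\partial u}{\partial t}=a_m\partial_x^m u .$$ Among these $m+1$ schemes there is at most one stable algorithm for each value of $m$ and each sign of $a_m$. More precisely: (i) If $m=2\ell$ with $\ell\ge1$, the algorithm $r=\ell$ is stable only for $\mathrm{sgn}(a_m)=(-1)^{\ell-1}$ (and it is stable for this sign); for $\mathrm{sgn}(a_m)=(-1)^{\ell}$ there are no stable algorithms. (ii) If $m=2\ell-1$ with $\ell\ge1$, the algorithms $r=\ell$ and $r=\ell-1$ are stable for $\mathrm{sgn}(a_m)=(-1)^{\ell}$ and $\mathrm{sgn}(a_m)=(-1)^{\ell-1}$ respectively.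
   Context: $\Delta t,\Delta x>0$ are the time step and grid spacing, so $\mathrm{sgn}(\nu_m)=\mathrm{sgn}(a_m)$, and $C_k^m=\frac{m!}{k!(m-k)!}$. The amplification factor of the scheme for a Fourier mode $e^{ipx}$, with $\theta=p\Delta x$, is $g(\theta)=\sum_{k=-r}^{m-r}c_ke^{ik\theta}$; the scheme is von Neumann stable at a given $\nu_m$ if $|g(\theta)|\le1$ for all $\theta\in[0,2\pi]$. For a given sign of $a_m$, the algorithm labelled by $r$ is called stable if it is von Neumann stable for all $\nu_m$ of that sign with $|\nu_m|>0$ sufficiently small. *)

(* Defs.v *)
From mathcomp Require Import all_boot all_order all_algebra.
From mathcomp Require Import complex.
From mathcomp Require Import reals trigo.
From mathcomp Require Import ring.

Set Implicit Arguments.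
Unset Strict Implicit.
Unset Printing Implicit Defensive.

Import Order.TTheory GRing.Theory Num.Theory.

Local Open Scope ring_scope.
Local Open Scope complex_scope.

Definition expi (R : realType) (t : R) : R[i] := cos t +i* sin t.

Definition courant (R : realType) (m : nat) (a dt dx : R) : R :=
  dt * a / dx ^+ m.

(* Only used for - r <= k <= m - r, so that r + k is a natural number and the
   absolute value is a mere cast from int to nat. *)
Definition scheme_coef (R : realType) (m r : nat) (nu : R) (k : int) : R :=
  if k == 0 then 1 + (-1) ^+ m * (-1) ^+ r * 'C(m, r)%:R * nu
  else (-1) ^+ m * (-1) ^ (r%:Z + k) * 'C(m, absz (r%:Z + k))%:R * nu.

(* In both sums below, the stencil offset k in [- r, m - r] is j - r with
   0 <= j <= m. *)
Definition scheme_step (R : realType) (m r : nat) (nu dx : R)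
    (u : R -> R[i]) (x : R) : R[i] :=
  \sum_(j < m.+1)
    (scheme_coef m r nu (j%:Z - r%:Z))%:C * u (x + (j%:Z - r%:Z)%:~R * dx).

Definition amplification (R : realType) (m r : nat) (nu theta : R) : R[i] :=
  \sum_(j < m.+1)
    (scheme_coef m r nu (j%:Z - r%:Z))%:C * expi ((j%:Z - r%:Z)%:~R * theta).

Definition von_neumann_stable (R : realType) (m r : nat) (nu : R) : Prop :=
  forall theta : R, 0 <= theta <= 2 * pi ->
    `|amplification m r nu theta| <= 1.

(* s is the sign, 1 or -1, of the coefficient a of the equation; by sgr_courant
   it is also the sign of the Courant number nu. *)
Definition stable_algorithm (R : realType) (m r : nat) (s : R) : Prop :=
  exists2 delta : R, 0 < delta &
    forall nu : R, Num.sg nu = s -> 0 < `|nu| < delta ->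
      von_neumann_stable m r nu.

Lemma sgr_courant (R : realType) (m : nat) (a dt dx : R) :
  0 < dt -> 0 < dx -> Num.sg (courant m a dt dx) = Num.sg a.
Proof.
move=> dt0 dx0.
have dxm0 : 0 < (dx ^+ m)^-1 by rewrite invr_gt0 exprn_gt0.
by rewrite /courant !sgrM (gtr0_sg dt0) (gtr0_sg dxm0) mul1r mulr1.
Qed.

Lemma expiD (R : realType) (s t : R) : expi (s + t) = expi s * expi t.
Proof.
by rewrite /expi cosD sinD; apply/eqP; rewrite eq_complex /=;
  apply/andP; split; apply/eqP; ring.
Qed.

Lemma scheme_step_fourier (R : realType) (m r : nat) (nu dx p x : R) :
  scheme_step m r nu dx (fun y => expi (p * y)) x
  = amplification m r nu (p * dx) * expi (p * x).
Proof.
rewrite /scheme_step /amplification mulr_suml; apply: eq_bigr => j _.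
by rewrite -mulrA -expiD; congr (_ * expi _); ring.
Qed.

(* Main.v *)
(** With [theta = 2 psi + pi] one has [e^(i theta) - 1 = - 2 cos psi e^(i psi)], so
    the amplification factor is
    [g = 1 + (-1)^(m + r) nu (2 cos psi)^m e^(i (m - 2 r) psi)]
    with [psi] ranging over [[- pi / 2, pi / 2]]. At [psi = 0] the bound [|g| <= 1]
    forces the sign of [nu] to be [- (-1)^(m + r)]; if [|m - 2 r| >= 2], then at
    [psi = pi / (2 |m - 2 r|)] the second term is purely imaginary and nonzero, so
    that [|g| > 1]. Conversely, if [|m - 2 r| <= 1] then
    [cos ((m - 2 r) psi) >= cos psi], and the bound holds for [2^m |nu| < 1].
    Hence stability amounts to [|m - 2 r| <= 1] together with
    [sgn nu = - (-1)^(m + r)]. *)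
Require Import Defs.
From mathcomp Require Import all_boot all_order all_algebra.
From mathcomp Require Import complex reals trigo.
From mathcomp Require Import zify ring lra.

Import Order.TTheory GRing.Theory Num.Theory.
Local Open Scope ring_scope.
Local Open Scope complex_scope.

Lemma expi0 (R : realType) : expi (0 : R) = 1.
Proof. by rewrite /expi cos0 sin0. Qed.

Lemma expi_natmul (R : realType) (n : nat) (t : R) : expi (n%:R * t) = expi t ^+ n.
Proof.
elim: n => [|n IH]; first by rewrite mul0r expi0 expr0.
by rewrite -natr1 mulrDl mul1r expiD IH exprSr.
Qed.

Lemma expi_mulN (R : realType) (t : R) : expi t * expi (- t) = 1.
Proof. by rewrite -expiD subrr expi0. Qed.

Lemma expiDpi (R : realType) (t : R) : expi (t + pi) = - expi t.
Proof. by rewrite /expi cosDpi sinDpi. Qed.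

Lemma expiBpi (R : realType) (t : R) : expi (t - pi) = - expi t.
Proof. by rewrite -[t in RHS](subrK pi) expiDpi opprK. Qed.

Lemma expi_add1 (R : realType) (t : R) :
  1 + expi t ^+ 2 = (2 * cos t)%:C * expi t.
Proof.
rewrite -{1}(expi_mulN _ t) expr2 -mulrDr mulrC; congr (_ * _).
rewrite /expi cosN sinN; apply/eqP; rewrite eq_complex /=.
by apply/andP; split; apply/eqP; ring.
Qed.

(** With [j = r + k], the case split at [k = 0] becomes a Kronecker delta, and what remains is an
    alternating binomial term ready for the binomial theorem. *)
Lemma scheme_coefE (R : realType) (m r j : nat) (nu : R) :
  scheme_coef m r nu (j%:Z - r%:Z)
  = (j == r)%:R + (-1) ^+ m * nu * ((-1) ^+ j * 'C(m, j)%:R).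
Proof.
rewrite /scheme_coef subr_eq0 eqz_nat; case: eqP => [->|_] /=; first by ring.
have -> : r%:Z + (j%:Z - r%:Z) = j by rewrite addrC subrK.
by rewrite -exprnP add0r; ring.
Qed.

Lemma amplificationE (R : realType) (m r : nat) (nu psi : R) : (r <= m)%N ->
  amplification m r nu (2 * psi + pi)
  = 1 + ((-1) ^+ (m + r) * nu * (2 * cos psi) ^+ m)%:C
        * expi ((m%:Z - (2 * r)%:Z)%:~R * psi).
Proof.
move=> rm; set theta := 2 * psi + pi.
have eth : expi theta = - expi psi ^+ 2 by rewrite expiDpi -expi_natmul.
have eNth : expi (- theta) = - expi (- psi) ^+ 2.
  by rewrite opprD -mulrN expiBpi -expi_natmul.
have eshift (j : nat) :
    expi ((j%:Z - r%:Z)%:~R * theta) = expi (- theta) ^+ r * expi theta ^+ j.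
  by rewrite -!expi_natmul -expiD; congr expi; rewrite intrB; ring.
have -> : expi ((m%:Z - (2 * r)%:Z)%:~R * psi)
          = expi psi ^+ m * (expi (- psi) ^+ 2) ^+ r.
  rewrite -exprM -!expi_natmul -expiD; congr expi.
  by rewrite intrB; ring.
(* The delta part collapses to its term [j = r], which is 1; the binomial part sums to
   [(1 - e^(i theta))^m], shifted by [e^(- i r theta)]. *)
transitivity (\sum_(j < m.+1) ((nat_of_ord j == r)%:R : R[i])
  * (expi (- theta) ^+ r * expi theta ^+ j)
  + ((-1) ^+ m * nu)%:C * expi (- theta) ^+ r * (1 - expi theta) ^+ m).
  rewrite exprBn mulr_sumr -big_split /=; apply: eq_bigr => j _.
  rewrite scheme_coefE eshift expr1n mulr1 -mulr_natr.
  rewrite !(rmorphD, rmorphM, rmorphMn, rmorph1, rmorphXn, rmorphN1) /=.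
  ring.
congr (_ + _).
  rewrite (bigD1 (Ordinal (leq_ltn_trans rm (ltnSn m)))) //= eqxx mul1r.
  rewrite big1 => [|j]; last by rewrite -val_eqE /= => /negPf ->; rewrite mul0r.
  by rewrite addr0 -exprMn [X in X ^+ _]mulrC expi_mulN expr1n.
rewrite eth eNth opprK expi_add1 exprMn [(- _) ^+ r]exprNn exprD.
move: (2 * cos psi) => c.
by rewrite !rmorphM !rmorphXn !rmorphN1; ring.
Qed.

(** The squared modulus equals [1 + b (2 cos t + b)], so stability becomes a real inequality. *)
Lemma normc_le1_add (R : realType) (b t : R) :
  (`|1 + b%:C * expi t| <= 1) = (b * (2 * cos t + b) <= 0).
Proof.
have -> : 1 + b%:C * expi t = (1 + b * cos t) +i* (b * sin t).
  by apply/eqP; rewrite eq_complex /= ; apply/andP; split; apply/eqP; ring.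
rewrite normc_def lecR -[X in (_ <= X) = _]sqrtr1 ler_sqrt ?ler01 //=.
have -> : (1 + b * cos t) ^+ 2 + (b * sin t) ^+ 2 = 1 + b * (2 * cos t + b).
  by rewrite exprMn sin2cos2; ring.
by rewrite gerDl.
Qed.

Lemma von_neumann_stableP (R : realType) (m r : nat) (nu : R) : (r <= m)%N ->
  let b psi := (-1) ^+ (m + r) * nu * (2 * cos psi) ^+ m in
  von_neumann_stable m r nu <->
  forall psi, - (pi / 2) <= psi <= pi / 2 ->
    b psi * (2 * cos ((m%:Z - (2 * r)%:Z)%:~R * psi) + b psi) <= 0.
Proof.
move=> rm b; split=> [st psi psiI | H theta thetaI].
  by rewrite -normc_le1_add -amplificationE //; apply: st; lra.
have -> : theta = 2 * ((theta - pi) / 2) + pi by lra.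
by rewrite amplificationE // normc_le1_add; apply: H; lra.
Qed.

Lemma stable_algorithmP (R : realType) (m r : nat) (a : R) :
  (1 <= m)%N -> a != 0 -> (r <= m)%N ->
  stable_algorithm m r (Num.sg a) <->
  (`|m%:Z - (2 * r)%:Z| <= 1) /\ Num.sg a = (-1) ^+ (m + r).+1.
Proof.
move=> m1 a0 rm; set n := m%:Z - _.
have pi0 := pi_gt0 R.
have sg1 : (-1) ^+ (m + r) * (-1) ^+ (m + r) = 1 :> R.
  by rewrite -exprD addnn -muln2 exprM sqrr_sign.
have [e eE] : exists e : R, e = (-1) ^+ (m + r) by eexists.
have e0 : e != 0 by rewrite eE signr_eq0.
rewrite exprS -eE mulN1r; rewrite -eE in sg1.
split=> [[d d0 st] | [n1 sa]].
  (* A single admissible [nu] suffices: each necessary condition already follows from stability at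
     one nonzero [nu] of the given sign. *)
  set nu := Num.sg a * (d / 2).
  have nu0 : nu != 0 by rewrite mulf_neq0 ?sgr_eq0 //; lra.
  have := st nu.
  rewrite {1 2}/nu sgrM sgr_id (@gtr0_sg _ (d / 2)) ?mulr1; last lra.
  rewrite normrM normr_sg a0 mul1r gtr0_norm; last lra.
  have dI : 0 < d / 2 < d by lra.
  move=> /(_ erefl dI) /(von_neumann_stableP _ _ _ _ rm); rewrite -eE => {}st.
  split.
    rewrite leNgt; apply/negP => n2.
    set k := (`|n|)%N.
    have k2 : 2 <= k%:R :> R by rewrite ler_nat; lia.
    pose psi : R := pi / 2 / k%:R.
    have kpsi : k%:R * psi = pi / 2 by rewrite /psi mulrC divfK //; lra.
    have psi0 : 0 < psi by rewrite /psi !divr_gt0 //; lra.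
    have psi1 : psi < pi / 2 by nra.
    have npsi : cos (n%:~R * psi) = 0.
      rewrite -cos_norm normrM -intr_norm (gtr0_norm psi0) -abszE -pmulrn.
      by rewrite kpsi cos_pihalf.
    have c0 : 0 < cos psi by apply: cos_gt0_pihalf; lra.
    (* The cosine vanishes here, so the inequality reads [b^2 <= 0], although [b] is nonzero because
       [cos psi > 0]. *)
    have := st psi; rewrite npsi mulr0 add0r -expr2 => /(_ ltac:(lra)).
    apply/negP; rewrite -ltNge exprn_even_gt0 //=.
    by rewrite (mulf_neq0 (mulf_neq0 e0 nu0)) // expf_neq0 //; lra.
  (* At [psi = 0] the inequality is [b (2 + b) <= 0] with [b = e nu 2^m] nonzero, hence
     [e nu < 0]. *)
  have := st 0; rewrite mulr0 cos0 !mulr1 => /(_ ltac:(lra)).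
  have p0 : 0 < 2 ^+ m :> R by rewrite exprn_gt0.
  move: (2 ^+ m) p0 => p p0 h.
  have enu : e * nu < 0.
    rewrite lt_neqAle mulf_neq0 //=.
    rewrite leNgt; apply/negP => enu.
    have := mulr_gt0 enu p0; nra.
  have : e * Num.sg a < 0.
    by move: enu; rewrite mulrA pmulr_llt0 //; lra.
  have : Num.sg a ^+ 2 = 1 by rewrite sqr_sg a0.
  move=> s2 es0.
  have : (Num.sg a - e) * (Num.sg a + e) = 0 by ring: s2 sg1.
  move/eqP; rewrite mulf_eq0 subr_eq0 addr_eq0 => /orP[] /eqP // sae.
  by move: es0; rewrite sae sg1 ltr10.
(* This threshold gives [|b| <= c^m <= c <= cos (n psi)], while the sign of [nu] gives [b <= 0]; so
   [b (2 cos (n psi) + b) <= 0]. *)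
exists (2 ^+ m)^-1; first by rewrite invr_gt0 exprn_gt0.
move=> nu snu nuI; apply/(von_neumann_stableP _ _ _ _ rm) => psi psiI.
rewrite -eE -/n (numEsg nu) snu sa.
set c := cos psi.
have c0 : 0 <= c by apply: cos_ge0_pihalf.
have c1 : c <= 1 by apply: cos_le1.
have cn : c <= cos (n%:~R * psi).
  have : n = 0 \/ n = 1 \/ n = -1 by lia.
  case=> [->|[] ->]; rewrite ?mul0r ?cos0 // ?mulrNz ?mulNr ?cosN ?mul1r //.
have cm : c ^+ m <= c.
  by rewrite -(prednK m1) exprS ler_piMr // exprn_ile1.
have nu2 : `|nu| * 2 ^+ m <= 1.
  have p0 : 0 < 2 ^+ m :> R by rewrite exprn_gt0.
  by rewrite -ler_pdivlMr // div1r ltW //; case/andP: nuI.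
have -> : e * (- e * `|nu|) * (2 * c) ^+ m = - (`|nu| * 2 ^+ m * c ^+ m).
  by rewrite exprMn; move: (2 ^+ m) (c ^+ m) => p q; ring: sg1.
have q0 : 0 <= c ^+ m by apply: exprn_ge0.
have P0 : 0 <= `|nu| * 2 ^+ m by rewrite mulr_ge0 ?exprn_ge0.
rewrite mulNr oppr_le0; apply: mulr_ge0; first exact: mulr_ge0.
have : `|nu| * 2 ^+ m * c ^+ m <= c by apply: le_trans cm; apply: ler_piMl.
lra.
Qed.

Theorem theorem6 (R : realType) (m : nat) (a : R)
    (hm : (1 <= m)%N) (ha : a != 0) :
  (forall r1 r2 : nat, (r1 <= m)%N -> (r2 <= m)%N ->
     stable_algorithm m r1 (Num.sg a) -> stable_algorithm m r2 (Num.sg a) ->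
     r1 = r2) /\
  (forall l : nat, (1 <= l)%N -> m = (2 * l)%N ->
     (stable_algorithm m l (Num.sg a) <-> Num.sg a = (-1) ^+ (l - 1)) /\
     (Num.sg a = (-1) ^+ l ->
        forall r : nat, (r <= m)%N -> ~ stable_algorithm m r (Num.sg a))) /\
  (forall l : nat, (1 <= l)%N -> m = (2 * l - 1)%N ->
     (Num.sg a = (-1) ^+ l -> stable_algorithm m l (Num.sg a)) /\
     (Num.sg a = (-1) ^+ (l - 1) -> stable_algorithm m (l - 1) (Num.sg a))).
Proof.
have sign_eq (p q : nat) : odd p = odd q -> (-1) ^+ p = (-1) ^+ q :> R.
  by move=> pq; rewrite -signr_odd pq signr_odd.
have sign_odd (p q : nat) : (-1) ^+ p = (-1) ^+ q :> R -> odd p = odd q.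
  by rewrite -(signr_odd _ p) -(signr_odd _ q) => /signr_inj.
split=> [r1 r2 r1m r2m|]; last split=> [l l1 ml|l l1 ml].
- move=> /(stable_algorithmP _ _ _ _ hm ha r1m) [n1 s1].
  move=> /(stable_algorithmP _ _ _ _ hm ha r2m) [n2 s2].
  (* Equal signs give [r1] and [r2] the same parity, and the bounds on [m - 2 r] put them at
     distance at most 1. *)
  have := sign_odd _ _ (etrans (esym s1) s2).
  lia.
- split=> [|sa r rm].
    rewrite stable_algorithmP //; last lia.
    have -> : (-1) ^+ (m + l).+1 = (-1) ^+ (l - 1) :> R by apply: sign_eq; lia.
    by split=> [[]//|sa]; split=> //; lia.
  (* For even [m] the bound forces [r = l], and then [m + r + 1 = 3 l + 1] has the wrong parity. *)
  move=> /(stable_algorithmP _ _ _ _ hm ha rm) [n1]; rewrite sa => /sign_odd.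
  lia.
(* Here [m - 2 r] is -1 for [r = l] and 1 for [r = l - 1], and [m + r + 1] has the parity of [r] in
   both cases. *)
- split=> sa; apply/stable_algorithmP => //; try lia.
    by rewrite sa; split; [lia | apply: sign_eq; lia].
  by rewrite sa; split; [lia | apply: sign_eq; lia].
Qed.
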